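(* For every integer $n\geq 2$, the Schultz index of the pentagonal cylinder chain $P_n$ is \[\operatorname{Sc}(P_n)=\begin{cases}35n^3+48n^2+2n, & n \text{ even},\\ 35n^3+48n^2+n, & n \text{ odd}.\end{cases}\]
   Context: For $n\geq 2$, $P_n$ has vertex set $\{u_1,\dots,u_{2n}\}\cup\{u'_1,\dots,u'_{2n}\}\cup\{w_1,\dots,w_n\}$ and edges $u_ku_{k+1}$, $u'_ku'_{k+1}$ ($1\le k\le 2n-1$), $u_{2n}u_1$, $u'_{2n}u'_1$, $u_{2k-1}u'_{2k-1}$ ($1\le k\le n$), and $u_{2k}w_k$, $w_ku'_{2k}$ ($1\le k\le n$). For a connected graph with vertices $v_1,\dots,v_N$, degrees $d_i$ and shortest-path distances $d_{ij}$, the Schultz index is $\operatorname{Sc}(G)=\frac12\sum_{i=1}^N\sum_{j=1}^N (d_i+d_j)d_{ij}$. *)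

(* Defs.v *)
From mathcomp Require Import all_boot all_order all_algebra.
From mathcomp Require Import zify.
Set Implicit Arguments.
Unset Strict Implicit.
Unset Printing Implicit Defensive.

Record sgraph := SGraph {
  vertex :> finType;
  adj : rel vertex;
  adj_sym : symmetric adj;
  adj_irr : irreflexive adj }.

Definition connected (G : sgraph) : Prop := forall x y : G, connect (@adj G) x y.

Definition degree (G : sgraph) (x : G) : nat := #|[set y | adj x y]|.

Definition has_walk (G : sgraph) (x y : G) (k : nat) : bool :=
  [exists p : k.-tuple G, path (@adj G) x p && (last x p == y)].

(* Length of a shortest x-y walk.  A shortest walk has fewer than #|G| edges,
   so the search below always succeeds when y is reachable from x (see gdistP);
   the value is #|G| for vertices in different components. *)
Definition gdist (G : sgraph) (x y : G) : nat :=
  find (has_walk x y) (iota 0 #|G|).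

Lemma has_walkP (G : sgraph) (x y : G) (k : nat) :
  reflect (exists p, [/\ path (@adj G) x p, last x p = y & size p = k])
          (has_walk x y k).
Proof.
apply: (iffP existsP) => [[p /andP[px /eqP py]] | [p [px py pk]]].
  by exists p; rewrite size_tuple.
by move/eqP: pk => pk; exists (Tuple pk); rewrite /= px py eqxx.
Qed.

Lemma gdistP (G : sgraph) (x y : G) : connect (@adj G) x y ->
  (exists p, [/\ path (@adj G) x p, last x p = y & size p = gdist x y]) /\
  (forall p, path (@adj G) x p -> last x p = y -> gdist x y <= size p).
Proof.
case/connectP=> p0 p0x yE.
have [q [qx qy qs]] : exists q, [/\ path (@adj G) x q, last x q = y & size q < #|G|].
  case/shortenP: p0x yE => q qx qu _ yE; exists q; split=> //.
  by have := max_card (mem (x :: q)); rewrite (card_uniqP qu).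
have hasw : has (has_walk x y) (iota 0 #|G|).
  apply/hasP; exists (size q); first by rewrite mem_iota.
  by apply/has_walkP; exists q.
have lt_d : gdist x y < #|G| by move: hasw; rewrite has_find size_iota.
split.
  have := nth_find 0 hasw; rewrite -/(gdist x y) nth_iota // add0n.
  by move/has_walkP.
move=> p px py; rewrite leqNgt; apply/negP => lt_p.
have := before_find 0 lt_p; rewrite nth_iota ?(ltn_trans lt_p) // add0n.
suff -> : has_walk x y (size p) by [].
by apply/has_walkP; exists p.
Qed.

(* Meaningful for connected graphs. *)
Definition Schultz (G : sgraph) : rat :=
  (2%:R^-1 * (\sum_(x : G) \sum_(y : G) (degree x + degree y) * gdist x y)%N%:R)%R.

(* inl (inl i), inl (inr i) and inr i stand for u_(i+1), u'_(i+1) and w_(i+1):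
   ordinals start at 0, so odd subscripts are even ordinals and u_(2k) is the
   ordinal 2(k-1)+1. *)
Definition pent_vertex (n : nat) : finType :=
  (('I_(2 * n) + 'I_(2 * n)) + 'I_n)%type.

Definition cycle_arc (m : nat) (i j : 'I_m) : bool :=
  (j == i.+1 :> nat) || ((i.+1 == m) && (j == 0 :> nat)).

Definition pent_arc (n : nat) (x y : pent_vertex n) : bool :=
  match x, y with
  | inl (inl i), inl (inl j) => cycle_arc i j
  | inl (inr i), inl (inr j) => cycle_arc i j
  | inl (inl i), inl (inr j) => ~~ odd i && (i == j)
  | inl (inl i), inr k => i == (2 * k).+1 :> nat
  | inr k, inl (inr j) => j == (2 * k).+1 :> nat
  | _, _ => false
  end.

Definition pent_adj (n : nat) : rel (pent_vertex n) :=
  fun x y => pent_arc x y || pent_arc y x.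

Lemma pent_adj_sym (n : nat) : symmetric (@pent_adj n).
Proof. by move=> x y; rewrite /pent_adj orbC. Qed.

Lemma pent_adj_irr (n : nat) : irreflexive (@pent_adj n).
Proof.
by case=> [[i|i]|k] //; rewrite /pent_adj orbb /= /cycle_arc; apply/negbTE/negP; lia.
Qed.

Definition pent_cylinder (n : nat) : sgraph :=
  SGraph (@pent_adj_sym n) (@pent_adj_irr n).

Lemma pent_cylinder_connected (n : nat) : connected (pent_cylinder n).
Proof.
case: n => [|n]; first by case=> [[[]|[]]|[]].
have lt0 : 0 < 2 * n.+1 by [].
pose u0 : pent_cylinder n.+1 := inl (inl (Ordinal lt0)).
have csym : connect_sym (@adj (pent_cylinder n.+1)).
  exact/sym_connect_sym/adj_sym.
suff c0 x : connect (@adj (pent_cylinder n.+1)) u0 x.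
  by move=> x y; apply: connect_trans (c0 y); rewrite csym.
have cu m (Hm : m < 2 * n.+1) :
    connect (@adj (pent_cylinder n.+1)) u0 (inl (inl (Ordinal Hm))).
  elim: m Hm => [|m IHm] Hm.
    by rewrite (_ : Ordinal Hm = Ordinal lt0) ?connect0 //; apply: val_inj.
  apply: connect_trans (IHm (ltnW Hm)) (connect1 _).
  by rewrite /= /pent_adj /= /cycle_arc /= eqxx.
have cu' m (Hm : m < 2 * n.+1) :
    connect (@adj (pent_cylinder n.+1)) u0 (inl (inr (Ordinal Hm))).
  elim: m Hm => [|m IHm] Hm.
    apply: connect_trans (cu _ Hm) (connect1 _).
    by [].
  apply: connect_trans (IHm (ltnW Hm)) (connect1 _).
  by rewrite /= /pent_adj /= /cycle_arc /= eqxx.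
case: x => [[[m Hm]|[m Hm]]|[k Hk]] //.
have Hk' : (2 * k).+1 < 2 * n.+1 by lia.
apply: connect_trans (cu _ Hk') (connect1 _).
by rewrite /= /pent_adj /= eqxx.
Qed.

(* Main.v *)
Require Import Defs.
From mathcomp Require Import all_boot all_order all_algebra.
From mathcomp Require Import zify.
Set Implicit Arguments.
Unset Strict Implicit.
Unset Printing Implicit Defensive.

(* Collapsing the three layers onto a 2n-cycle (w_k onto the column of u_(2k))
   does not increase distances, so d(x, y) is the cyclic distance of the columns
   plus a correction depending on the layers.  The one exception is that
   d(u_i, u'_i) is 2 rather than 1 when the column carries a w: between distinct
   columns a shortest path can always use a direct rung.  Summing
   deg(x) d(x, y) over all pairs then only needs the fact that the cyclic
   distances from a vertex of an m-cycle add up to floor(m^2 / 4); the parity of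
   n enters through the distances among the w_k, which are twice those of an
   n-cycle. *)

(** The third hypothesis makes [D] grow by at most one per edge, so no walk from [x] to [y] is
    shorter than [D y]. The fourth traces a walk of length exactly [D y] back from [y]. Verifying a
    distance formula thus becomes a local check on edges. *)
Lemma gdist_unique (G : sgraph) (x : G) (D : G -> nat) :
  connected G -> D x = 0 ->
  (forall y z, adj y z -> D z <= (D y).+1) ->
  (forall y, y != x -> exists2 z, adj z y & D y = (D z).+1) ->
  forall y, gdist x y = D y.
Proof.
move=> cG Dx Dlip Ddesc y.
have [[p [px py <-]] gmin] := gdistP (cG x y).
apply/eqP; rewrite eqn_leq; apply/andP; split; last first.
  have lip q a : path (@adj G) a q -> D (last a q) <= D a + size q.
    elim: q a => [|b q IHq] a /=; first by lia.
    by case/andP=> /Dlip ab /IHq; lia.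
  by rewrite -py; have := lip p x px; rewrite Dx.
have [q [qx qy <-]] : exists q, [/\ path (@adj G) x q, last x q = y & size q = D y].
  have [k] := ubnP (D y); elim: k => // k IHk in y {p px py gmin} *.
  move=> Dy; have [->|/Ddesc[z zy Dz]] := eqVneq y x; first by exists [::].
  have [|q [qx qz qs]] := IHk z; first by lia.
  exists (rcons q y); rewrite rcons_path qx qz zy last_rcons size_rcons qs Dz.
  by split.
exact: gmin.
Qed.

(** * Distances and neighbours on an m-cycle *)

Definition cycle_dist (m i j : nat) : nat :=
  minn ((i - j) + (j - i)) (m - ((i - j) + (j - i))).

Lemma cycle_distC (m i j : nat) : cycle_dist m i j = cycle_dist m j i.
Proof. by rewrite /cycle_dist addnC. Qed.

Lemma cycle_dist_double (m i j : nat) :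
  cycle_dist (2 * m) (2 * i).+1 (2 * j).+1 = 2 * cycle_dist m i j.
Proof. by rewrite /cycle_dist; lia. Qed.

(** Going from m to m + 2, the term j = 0 vanishes and each of the other m + 1 terms is one more
    than a term of the sum for m, matching (m + 2)^2 = 4(m + 1) + m^2. *)
Lemma sum_minn_sub (m : nat) : \sum_(j < m) minn j (m - j) = m ^ 2 %/ 4.
Proof.
have [k] := ubnP m; elim: k m => // k IHk [|[|m]] lt_mk.
- by rewrite big_ord0.
- by rewrite big_ord_recl big_ord0.
rewrite big_ord_recl min0n add0n.
rewrite (eq_bigr (fun j : 'I_m.+1 => 1 + minn j (m - j))); last first.
  by move=> j _; have := ltn_ord j; rewrite lift0; lia.
rewrite big_split /= sum1_card card_ord big_ord_recr /= subnn minn0 addn0.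
rewrite IHk; last by lia.
have -> : m.+2 ^ 2 = m.+1 * 4 + m ^ 2 by rewrite -addn2 sqrnD; lia.
by rewrite divnMDl.
Qed.

Lemma sum_cycle_dist (m i : nat) : i < m ->
  \sum_(j < m) cycle_dist m i j = m ^ 2 %/ 4.
Proof.
elim: i => [|i IHi] lt_im.
  by rewrite -sum_minn_sub; apply: eq_bigr => j _; rewrite /cycle_dist; lia.
rewrite -IHi; last exact: ltnW.
case: m lt_im {IHi} => // m lt_im.
(* Rotation by one: j + 1 is as far from i + 1 as j is from i, and the split-off vertex 0 is as far
   from i + 1 as the last vertex is from i. *)
rewrite big_ord_recl big_ord_recr /= addnC; congr addn.
by rewrite /cycle_dist; lia.
Qed.

Lemma cycle_dist_arc (m i : nat) (j k : 'I_m) : i < m ->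
  cycle_arc j k || cycle_arc k j ->
  cycle_dist m i k <= (cycle_dist m i j).+1.
Proof.
have := (ltn_ord j, ltn_ord k) => -[].
by rewrite /cycle_arc /cycle_dist; lia.
Qed.

(** The [pred1] form serves both to exhibit a neighbour and to count neighbours; the disjunction
    records wrap-around for [lia]. *)
Lemma cycle_succ (m : nat) (j : 'I_m) :
  exists2 s : 'I_m, cycle_arc j =1 pred1 s &
    s = j.+1 :> nat \/ j.+1 = m /\ s = 0 :> nat.
Proof.
have lt_jm := ltn_ord j; have [lt_sm|le_ms] := ltnP j.+1 m.
  exists (Ordinal lt_sm); last by left.
  by move=> k; rewrite /cycle_arc /= -val_eqE /=; lia.
exists (Ordinal (leq_ltn_trans (leq0n j) lt_jm)).
  by move=> k; rewrite /cycle_arc /= -val_eqE /=; have := ltn_ord k; lia.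
by right; split=> //; lia.
Qed.

Lemma cycle_pred (m : nat) (j : 'I_m) :
  exists2 p : 'I_m, (@cycle_arc m)^~ j =1 pred1 p &
    j = p.+1 :> nat \/ p.+1 = m /\ j = 0 :> nat.
Proof.
have lt_jm := ltn_ord j; have [j0|j0] := posnP j.
  have lt_pm : m.-1 < m by lia.
  exists (Ordinal lt_pm); last by right=> /=; lia.
  by move=> k; rewrite /cycle_arc /= -val_eqE /=; have := ltn_ord k; lia.
exists (Ordinal (leq_ltn_trans (leq_pred j) lt_jm)); last by left=> /=; lia.
by move=> k; rewrite /cycle_arc /= -val_eqE /=; have := ltn_ord k; lia.
Qed.

Lemma cycle_dist_descent (m : nat) (i j : 'I_m) : i != j ->
  exists2 k : 'I_m, cycle_arc j k || cycle_arc k j &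
    cycle_dist m i j = (cycle_dist m i k).+1.
Proof.
rewrite -val_eqE /= => ne_ij.
have [s js sE] := cycle_succ j; have [p pj pE] := cycle_pred j.
have [ds|ds] := eqVneq (cycle_dist m i j) (cycle_dist m i s).+1.
  by exists s; rewrite // js /= eqxx.
exists p; first by rewrite pj /= eqxx orbT.
have [lt_im lt_jm] := (ltn_ord i, ltn_ord j).
move: ds; rewrite /cycle_dist {js pj}.
by case: sE => [->|[jm ->]]; case: pE => [jp|[pm j0]]; case: (ltnP i j); lia.
Qed.

Lemma sum_cycle_arc (m : nat) (i : 'I_m) : 3 <= m ->
  \sum_(j < m) (cycle_arc i j || cycle_arc j i) = 2.
Proof.
move=> m3; have [s is_ sE] := cycle_succ i; have [p pi pE] := cycle_pred i.
(* This is where a length of at least 3 matters: on a 2-cycle the successor and the predecessor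
   coincide. *)
have ne_sp : s != p by rewrite -val_eqE /=; lia.
have -> : \sum_(j < m) (cycle_arc i j || cycle_arc j i) = #|[set s; p]|.
  rewrite -sum1_card [RHS]big_mkcond; apply: eq_bigr => j _.
  by rewrite is_ pi !inE /=; case: (_ || _).
by rewrite cards2 ne_sp.
Qed.

Lemma sum_ord_eq (m a : nat) : a < m -> \sum_(j < m) (j == a :> nat) = 1.
Proof.
move=> lt_am; rewrite (bigD1 (Ordinal lt_am)) //= eqxx big1 // => j.
by rewrite -val_eqE /= => /negbTE->.
Qed.

(** * The distance function of the pentagonal cylinder *)

(* [odd i] says that column i carries a w vertex instead of a direct rung. *)
Definition pent_dist (n : nat) (x y : pent_vertex n) : nat :=
  match x, y with
  | inl (inl i), inl (inl j) | inl (inr i), inl (inr j) =>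
      cycle_dist (2 * n) i j
  | inl (inl i), inl (inr j) | inl (inr i), inl (inl j) =>
      (cycle_dist (2 * n) i j).+1 + (odd i && (i == j))
  | inl (inl i), inr k | inl (inr i), inr k
  | inr k, inl (inl i) | inr k, inl (inr i) =>
      (cycle_dist (2 * n) (2 * k).+1 i).+1
  | inr k, inr l =>
      if k == l then 0 else (cycle_dist (2 * n) (2 * k).+1 (2 * l).+1).+2
  end.

Lemma cycle_dist0 (m i : nat) : cycle_dist m i i = 0.
Proof. by rewrite /cycle_dist subnn min0n. Qed.

Lemma cycle_arc_odd (n : nat) (i j : 'I_(2 * n)) :
  cycle_arc i j || cycle_arc j i -> odd i = ~~ odd j.
Proof. by have := (ltn_ord i, ltn_ord j); rewrite /cycle_arc => -[]; lia. Qed.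

(** Reduces a symmetric property of adjacent vertices to the five edge families: two cycles, rungs,
    and the two halves of each subdivided rung. *)
Lemma pent_adj_cases (n : nat) (Q : pent_vertex n -> pent_vertex n -> Prop) :
  (forall x y, Q x y -> Q y x) ->
  (forall i j : 'I_(2 * n), cycle_arc i j || cycle_arc j i ->
    Q (inl (inl i)) (inl (inl j))) ->
  (forall i j : 'I_(2 * n), cycle_arc i j || cycle_arc j i ->
    Q (inl (inr i)) (inl (inr j))) ->
  (forall i : 'I_(2 * n), ~~ odd i -> Q (inl (inl i)) (inl (inr i))) ->
  (forall (i : 'I_(2 * n)) (k : 'I_n), i = (2 * k).+1 :> nat ->
    Q (inl (inl i)) (inr k)) ->
  (forall (i : 'I_(2 * n)) (k : 'I_n), i = (2 * k).+1 :> nat ->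
    Q (inl (inr i)) (inr k)) ->
  forall x y, pent_adj x y -> Q x y.
Proof.
move=> Qsym Quu Qvv Quv Quw Qvw [[i|i]|k] [[j|j]|l]; rewrite /pent_adj /= ?orbF //.
- exact: Quu.
- by case/andP=> ? /eqP<-; apply: Quv.
- by move/eqP; apply: Quw.
- by case/andP=> ? /eqP<-; apply/Qsym/Quv.
- exact: Qvv.
- by move/eqP; apply: Qvw.
- by move/eqP=> ?; apply/Qsym/Quw.
- by move/eqP=> ?; apply/Qsym/Qvw.
Qed.

Lemma pent_dist_adj (n : nat) (x y z : pent_vertex n) : pent_adj y z ->
  pent_dist x z <= (pent_dist x y).+1.
Proof.
(* Both inequalities are proved together because [pent_adj_cases] needs a property symmetric in [y]
   and [z]. *)
move=> yz; suff /andP[] : (pent_dist x z <= (pent_dist x y).+1)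
  && (pent_dist x y <= (pent_dist x z).+1) by [].
(* The extra 1 at [a == j] is harmless: the cyclic distance is 0 there. *)
have cross (a i j : 'I_(2 * n)) : cycle_arc i j || cycle_arc j i ->
    (cycle_dist (2 * n) a j).+1 + (odd a && (a == j)) <=
    ((cycle_dist (2 * n) a i).+1 + (odd a && (a == i))).+1.
  move=> ij; have [->|ne_aj] := eqVneq a j; first by rewrite cycle_dist0; lia.
  by have := cycle_dist_arc (ltn_ord a) ij; lia.
have even_diag (a i : 'I_(2 * n)) : ~~ odd i -> odd a && (a == i) = false.
  by move=> i_ev; have [->|_] := eqVneq a i; rewrite ?andbF ?(negPf i_ev).
have lt_odd (a : 'I_n) : (2 * a).+1 < 2 * n by have := ltn_ord a; lia.
move: y z yz; apply: pent_adj_cases => [y z|i j ij|i j ij|i i_ev|i k ik|i k ik].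
- by rewrite andbC.
- have ji : cycle_arc j i || cycle_arc i j by rewrite orbC.
  case: x => [[a|a]|a]; apply/andP; split; rewrite /= 1?ltnS;
  by [exact: cross | exact: cycle_dist_arc].
- have ji : cycle_arc j i || cycle_arc i j by rewrite orbC.
  case: x => [[a|a]|a]; apply/andP; split; rewrite /= 1?ltnS;
  by [exact: cross | exact: cycle_dist_arc].
- by case: x => [[a|a]|a] /=; rewrite ?even_diag //; lia.
- case: x => [[a|a]|a] /=; rewrite -?ik ?(cycle_distC _ i a); try lia.
  by have [ak|_] := eqVneq a k; rewrite -?ik; last lia; rewrite ak ik cycle_dist0.
- case: x => [[a|a]|a] /=; rewrite -?ik ?(cycle_distC _ i a); try lia.
  by have [ak|_] := eqVneq a k; rewrite -?ik; last lia; rewrite ak ik cycle_dist0.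
Qed.

Lemma pent_dist_descent (n : nat) (x y : pent_vertex n) : y != x ->
  exists2 z, pent_adj z y & pent_dist x y = (pent_dist x z).+1.
Proof.
have lt_odd (a : 'I_n) : (2 * a).+1 < 2 * n by have := ltn_ord a; lia.
have half_odd (i : 'I_(2 * n)) : odd i -> exists k : 'I_n, i = Ordinal (lt_odd k).
  move=> i_odd; have lt_k : i./2 < n by have := ltn_ord i; lia.
  by exists (Ordinal lt_k); apply: val_inj => /=; lia.
(* Neighbouring columns have opposite parity, so if the descent reaches column i itself, then i is
   even and carries no correction. *)
have cross (i j : 'I_(2 * n)) : odd j -> i != j ->
    exists2 k : 'I_(2 * n), cycle_arc k j || cycle_arc j k &
      (cycle_dist (2 * n) i j).+1 + (odd i && (i == j)) =
      ((cycle_dist (2 * n) i k).+1 + (odd i && (i == k))).+1.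
  move=> j_odd ne_ij; have [k jk ->] := cycle_dist_descent ne_ij.
  exists k; first by rewrite orbC.
  rewrite (negPf ne_ij) andbF addn0; have [ik|_] := eqVneq i k; last by lia.
  by have := cycle_arc_odd jk; rewrite ik j_odd => /esym/negbTE->; rewrite addn0.
have near (i j : 'I_(2 * n)) : i != j ->
    exists2 k : 'I_(2 * n), cycle_arc k j || cycle_arc j k &
      cycle_dist (2 * n) i j = (cycle_dist (2 * n) i k).+1.
  by move=> /cycle_dist_descent[k jk ->]; exists k; rewrite // orbC.
case: x y => [[i|i]|k] [[j|j]|l] ne.
- have [|k kj /= ->] := near i j; first by apply: contraNneq ne => ->.
  by exists (inl (inl k)).
(* An even target column is entered by its rung. An odd one is entered along the target's own cycle,
   unless it is the source column, where the path goes through w. *)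
- have [j_odd|j_ev] := boolP (odd j); last first.
    exists (inl (inl j)); first by rewrite /pent_adj /= j_ev eqxx.
    by rewrite /=; have [->|] := eqVneq i j; rewrite ?(negPf j_ev) ?andbF addn0.
  have [ij|/(cross _ _ j_odd)[k kj e]] := eqVneq i j; last by exists (inl (inr k)).
  have [k jk] := half_odd _ j_odd; exists (inr k).
    by rewrite /pent_adj /= jk /= eqxx.
  by rewrite /= ij eqxx j_odd jk /= !cycle_dist0.
- exists (inl (inl (Ordinal (lt_odd l)))); first by rewrite /pent_adj /= eqxx.
  by rewrite /= cycle_distC.
- have [j_odd|j_ev] := boolP (odd j); last first.
    exists (inl (inr j)); first by rewrite /pent_adj /= j_ev eqxx.
    by rewrite /=; have [->|] := eqVneq i j; rewrite ?(negPf j_ev) ?andbF addn0.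
  have [ij|/(cross _ _ j_odd)[k kj e]] := eqVneq i j; last by exists (inl (inl k)).
  have [k jk] := half_odd _ j_odd; exists (inr k).
    by rewrite /pent_adj /= jk /= eqxx.
  by rewrite /= ij eqxx j_odd jk /= !cycle_dist0.
- have [|k kj /= ->] := near i j; first by apply: contraNneq ne => ->.
  by exists (inl (inr k)).
- exists (inl (inr (Ordinal (lt_odd l)))); first by rewrite /pent_adj /= eqxx.
  by rewrite /= cycle_distC.
- have [kj|/near[i ij /= e]] := eqVneq (Ordinal (lt_odd k)) j; last first.
    by exists (inl (inl i)); rewrite /= ?e.
  exists (inr k); first by rewrite /pent_adj /= -kj /= eqxx.
  by rewrite /= eqxx -kj cycle_dist0.
- have [kj|/near[i ij /= e]] := eqVneq (Ordinal (lt_odd k)) j; last first.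
    by exists (inl (inr i)); rewrite /= ?e.
  exists (inr k); first by rewrite /pent_adj /= -kj /= eqxx.
  by rewrite /= eqxx -kj cycle_dist0.
- exists (inl (inl (Ordinal (lt_odd l)))); first by rewrite /pent_adj /= eqxx.
  by rewrite /=; have [kl|_] := eqVneq k l; first by case/eqP: ne; rewrite kl.
Qed.

Lemma gdist_pent (n : nat) (x y : pent_cylinder n) : gdist x y = pent_dist x y.
Proof.
apply: gdist_unique => [||z t|z]; first exact: pent_cylinder_connected.
- by case: x => [[i|i]|k] /=; rewrite ?cycle_dist0 ?eqxx.
- exact: pent_dist_adj.
- exact: pent_dist_descent.
Qed.

(** * Degrees and sums of distances from a vertex *)

Lemma sum_pent (n : nat) (F : pent_vertex n -> nat) :
  \sum_x F x = \sum_(i < 2 * n) F (inl (inl i)) +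
    \sum_(i < 2 * n) F (inl (inr i)) + \sum_(k < n) F (inr k).
Proof. by rewrite big_sumType /= big_sumType. Qed.

Lemma sum_odd_eq (n i : nat) : i < 2 * n ->
  \sum_(k < n) (i == (2 * k).+1 :> nat) = odd i.
Proof.
move=> lt_i; have [i_odd|i_ev] := boolP (odd i); last first.
  by rewrite big1 // => k _; lia.
rewrite (eq_bigr (fun k : 'I_n => nat_of_bool (k == i./2 :> nat))); last first.
  by move=> k _; lia.
by apply: sum_ord_eq; lia.
Qed.

(** Double counting of the pairs formed by a w vertex and its column. *)
Lemma sum_odd (n : nat) : \sum_(i < 2 * n) odd i = n.
Proof.
under eq_bigr => i _ do rewrite -(sum_odd_eq (ltn_ord i)).
rewrite exchange_big -[RHS]card_ord -sum1_card; apply: eq_bigr => k _.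
by apply: sum_ord_eq; have := ltn_ord k; lia.
Qed.

Lemma degree_pent (n : nat) (x : pent_cylinder n) : 2 <= n ->
  degree x = if x is inr _ then 2 else 3.
Proof.
move=> n2; have n4 : 3 <= 2 * n by lia.
have rung (i : 'I_(2 * n)) : \sum_(j < 2 * n) (~~ odd j && (j == i)) = ~~ odd i.
  rewrite (bigD1 i) //= eqxx andbT big1 ?addn0 // => j /negbTE->.
  by rewrite andbF.
have spoke (k : 'I_n) : \sum_(i < 2 * n) (i == (2 * k).+1 :> nat) = 1.
  by apply: sum_ord_eq; have := ltn_ord k; lia.
have -> : degree x = \sum_y pent_adj x y.
  rewrite /degree -sum1_card [LHS]big_mkcond; apply: eq_bigr => y _.
  by rewrite inE /=; case: pent_adj.
rewrite sum_pent /pent_adj /=; case: x => [[i|i]|k] /=.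
(* Two cycle neighbours, plus either a rung (even column) or a w (odd column). *)
- rewrite sum_cycle_arc // (_ : 3 = 2 + ~~ odd i + odd i); last by case: odd.
  rewrite -rung -(sum_odd_eq (ltn_ord i)); congr (_ + _ + _).
    by apply: eq_bigr => j _; rewrite orbF; case: eqVneq => [->|]; rewrite ?andbF.
  by apply: eq_bigr => k _; rewrite orbF.
- rewrite sum_cycle_arc // rung (sum_odd_eq (ltn_ord i)).
  by case: odd.
- rewrite spoke big1_eq addn0 add1n; congr S; rewrite -[RHS](spoke k).
  by apply: eq_bigr => j _; rewrite orbF.
Qed.

Lemma pent_distC (n : nat) (x y : pent_vertex n) : pent_dist x y = pent_dist y x.
Proof.
case: x y => [[i|i]|k] [[j|j]|l] //=; rewrite cycle_distC //.
- by rewrite [j == i]eq_sym; case: eqVneq => [->|]; rewrite ?andbF.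
- by rewrite [j == i]eq_sym; case: eqVneq => [->|]; rewrite ?andbF.
- by rewrite eq_sym.
Qed.

(** The sum over the odd columns is left unevaluated: only its total over all i is needed, and
    exchanging the summations turns that into full-cycle sums. *)
Lemma sum_pent_dist_u (n : nat) (x : 'I_(2 * n) + 'I_(2 * n)) :
  let i := match x with inl i | inr i => i end in
  \sum_y pent_dist (inl x : pent_vertex n) y =
    2 * n ^ 2 + 3 * n + odd i + \sum_(k < n) cycle_dist (2 * n) (2 * k).+1 i.
Proof.
have quarter : (2 * n) ^ 2 %/ 4 = n ^ 2 by rewrite expnMn mulKn.
have cross (i : 'I_(2 * n)) : \sum_(j < 2 * n)
    ((cycle_dist (2 * n) i j).+1 + (odd i && (i == j))) = n ^ 2 + 2 * n + odd i.
  under eq_bigr do rewrite -addn1.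
  rewrite !big_split /= sum_cycle_dist // quarter sum1_card card_ord; congr addn.
  by rewrite (bigD1 i) //= eqxx andbT big1 ?addn0 // => j;
    rewrite eq_sym => /negbTE->; rewrite andbF.
have spoke i : \sum_(k < n) (cycle_dist (2 * n) (2 * k).+1 i).+1 =
    \sum_(k < n) cycle_dist (2 * n) (2 * k).+1 i + n.
  under eq_bigr do rewrite -addn1.
  by rewrite big_split /= sum1_card card_ord.
case: x => i; rewrite sum_pent /= sum_cycle_dist // quarter cross spoke;
  move: (\sum_(k < n) _) => S; lia.
Qed.

(** The general formula for two w vertices would give 2 instead of 0 on the diagonal; the added 2
    compensates without a truncated subtraction. *)
Lemma sum_pent_dist_w (n : nat) (k : 'I_n) :
  \sum_y pent_dist (inr k : pent_vertex n) y + 2 =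
    2 * n ^ 2 + 6 * n + 2 * (n ^ 2 %/ 4).
Proof.
have quarter : (2 * n) ^ 2 %/ 4 = n ^ 2 by rewrite expnMn mulKn.
have lt_k : (2 * k).+1 < 2 * n by have := ltn_ord k; lia.
have spoke : \sum_(i < 2 * n) (cycle_dist (2 * n) (2 * k).+1 i).+1 = n ^ 2 + 2 * n.
  under eq_bigr do rewrite -addn1.
  by rewrite big_split /= sum_cycle_dist // quarter sum1_card card_ord.
have hubs : \sum_(l < n) (if k == l then 0
    else (cycle_dist (2 * n) (2 * k).+1 (2 * l).+1).+2) + 2
    = 2 * (n ^ 2 %/ 4) + 2 * n.
  rewrite -(sum_cycle_dist (ltn_ord k)) big_distrr /= [in RHS](bigD1 k) //=.
  rewrite (bigD1 k) //= eqxx cycle_dist0 add0n muln0 add0n.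
  rewrite [X in _ = _ + X](_ : 2 * n = \sum_(l < n | l != k) 2 + 2); last first.
    by rewrite sum_nat_const cardC1 card_ord; have := ltn_ord k; lia.
  rewrite addnA -big_split /=; congr addn; apply: eq_bigr => l.
  by rewrite eq_sym => /negbTE->; rewrite cycle_dist_double addn2.
rewrite sum_pent /= spoke -addnA hubs; lia.
Qed.

(** * Assembling the Schultz index *)

Theorem theorem10 (n : nat) (hn : 2 <= n) :
  Schultz (pent_cylinder n) =
    (if odd n then 35 * n ^ 3 + 48 * n ^ 2 + n
     else 35 * n ^ 3 + 48 * n ^ 2 + 2 * n)%N%:R%R :> rat.
Proof.
rewrite /Schultz; pose D (x : pent_vertex n) := \sum_y pent_dist x y.
(* By symmetry of the distance both degree terms contribute equally; the resulting factor 2 cancels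
   the 1/2. *)
have -> : \sum_(x : pent_cylinder n) \sum_(y : pent_cylinder n)
    (degree x + degree y) * gdist x y =
    2 * \sum_(x : pent_cylinder n) degree x * D x.
  under eq_bigr => x _ do under eq_bigr => y _ do rewrite gdist_pent mulnDl.
  under eq_bigr do rewrite big_split /=.
  rewrite big_split /= [RHS]mul2n -[RHS]addnn [X in _ + X]exchange_big /=.
  congr addn; apply: eq_bigr => x _; rewrite big_distrr //=.
  by apply: eq_bigr => y _; rewrite pent_distC.
rewrite GRing.natrM GRing.mulKf //; congr (_%:R)%R.
under eq_bigr => x _ do rewrite degree_pent //.
rewrite sum_pent /=.
have sumS : \sum_(i < 2 * n) \sum_(k < n) cycle_dist (2 * n) (2 * k).+1 i = n ^ 3.
  rewrite exchange_big /= (eq_bigr (fun=> n ^ 2)); last first.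
    move=> k _; rewrite sum_cycle_dist ?expnMn ?mulKn //.
    by have := ltn_ord k; lia.
  by rewrite sum_nat_const card_ord.
have sumU (x : 'I_(2 * n) -> 'I_(2 * n) + 'I_(2 * n)) :
    (forall i, match x i with inl j | inr j => j end = i) ->
    \sum_(i < 2 * n) 3 * D (inl (x i)) =
    3 * (2 * n * (2 * n ^ 2 + 3 * n) + n + n ^ 3).
  move=> xE; under eq_bigr => i _ do rewrite /D sum_pent_dist_u xE.
  rewrite -big_distrr big_split /= big_split /=.
  by rewrite sum_nat_const card_ord sum_odd sumS.
(* Each of the n hubs has degree 2 and a diagonal compensation of 2, whence 4n. *)
have sumW : \sum_(k < n) 2 * D (inr k) + 4 * n =
    2 * n * (2 * n ^ 2 + 6 * n + 2 * (n ^ 2 %/ 4)).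
  have -> : 4 * n = \sum_(k < n) 4 by rewrite sum_nat_const card_ord mulnC.
  rewrite -big_split /=.
  under eq_bigr => k _ do rewrite -[4]/(2 * 2) -mulnDr sum_pent_dist_w.
  by rewrite sum_nat_const card_ord mulnA [n * 2]mulnC.
rewrite (sumU (@inl _ _)) // (sumU (@inr _ _)) //.
move: sumW; move: (\sum_(k < n) _) => {D sumS sumU} W.
(* With n = 2m + b and b at most 1, n^2 = 4(m^2 + bm) + b. Each parity then leaves a polynomial
   identity in m. *)
have Q : n ^ 2 %/ 4 = n./2 ^ 2 + odd n * n./2.
  rewrite -{1}(odd_double_half n) -mul2n sqrnD.
  by case: odd; lia.
rewrite Q => {hn Q}; move: (odd_double_half n).
move: (odd n) (n./2) => b m <-.
case: b; lia.
Qed.
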